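(* Let $M$ be an ada. If $M_{\#}$ is atomless, then $M$ is atomless.
   Context: A $C$-algebra is an algebra $\langle M,\vee,\wedge,\neg\rangle$ of type $(2,2,1)$ satisfying, for all $\alpha,\beta,\gamma$: $\neg\neg\alpha=\alpha$; $\neg(\alpha\wedge\beta)=\neg\alpha\vee\neg\beta$; $(\alpha\wedge\beta)\wedge\gamma=\alpha\wedge(\beta\wedge\gamma)$; $\alpha\wedge(\beta\vee\gamma)=(\alpha\wedge\beta)\vee(\alpha\wedge\gamma)$; $(\alpha\vee\beta)\wedge\gamma=(\alpha\wedge\gamma)\vee(\neg\alpha\wedge\beta\wedge\gamma)$; $\alpha\vee(\alpha\wedge\beta)=\alpha$; $(\alpha\wedge\beta)\vee(\beta\wedge\alpha)=(\beta\wedge\alpha)\vee(\alpha\wedge\beta)$. A $C$-algebra with $T,F,U$ has nullary operations $T,F,U$: $T$ is the two-sided identity for $\wedge$, $F$ the two-sided identity for $\vee$, $U$ the fixed point of $\neg$. An ada is a $C$-algebra with $T,F,U$ together with a unary operation $(\cdot)^{\downarrow}$ satisfying $F^{\downarrow}=F$, $U^{\downarrow}=F$, $T^{\downarrow}=T$, $\alpha\wedge\beta^{\downarrow}=\alpha\wedge(\alpha\wedge\beta)^{\downarrow}$, $\alpha^{\downarrow}\vee\neg(\alpha^{\downarrow})=T$, $\alpha=\alpha^{\downarrow}\vee\alpha$. $M_{\#}=\{\alpha\in M:\alpha\vee\neg\alpha=T\}$. Order: $a\leq b$ iff $a\vee b=b$. For $A\subseteq M$ containing $F$, the atoms relative to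 $A$ are those $a\in A$, $a\neq F$, such that every $b\in A$ with $F\leq b\leq a$, $b\neq a$ equals $F$. $A$ is atomless if it has no atoms relative to $A$. *)

(* Defs.v *)
From HB Require Import structures.
From mathcomp Require Import all_boot boolp classical_sets.

Set Implicit Arguments.
Unset Strict Implicit.
Unset Printing Implicit Defensive.

Declare Scope calgebra_scope.
Delimit Scope calgebra_scope with C.
Local Open Scope classical_set_scope.

Reserved Notation "x \vee y" (at level 50, left associativity).
Reserved Notation "x \wedge y" (at level 40, left associativity).
Reserved Notation "\neg x" (at level 35, right associativity).
Reserved Notation "x ^dn" (at level 1, left associativity, format "x ^dn").

HB.mixin Record isCAlgebra M := {
  cor : M -> M -> M;
  cand : M -> M -> M;
  cneg : M -> M;
  cnegK : forall a, cneg (cneg a) = a;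
  cneg_and : forall a b, cneg (cand a b) = cor (cneg a) (cneg b);
  candA : forall a b c, cand (cand a b) c = cand a (cand b c);
  cand_orr : forall a b c, cand a (cor b c) = cor (cand a b) (cand a c);
  cand_orl : forall a b c,
    cand (cor a b) c = cor (cand a c) (cand (cand (cneg a) b) c);
  cor_absorb : forall a b, cor a (cand a b) = a;
  cand_or_comm : forall a b,
    cor (cand a b) (cand b a) = cor (cand b a) (cand a b)
}.

#[short(type="cAlgebraType")]
HB.structure Definition CAlgebra := { M of isCAlgebra M }.

Notation "x \vee y" := (cor x y) : calgebra_scope.
Notation "x \wedge y" := (cand x y) : calgebra_scope.
Notation "\neg x" := (cneg x) : calgebra_scope.

Local Open Scope calgebra_scope.

HB.mixin Record CAlgebra_hasTFU M of CAlgebra M := {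
  cT : M;
  cF : M;
  cU : M;
  candTx : forall a : M, cT \wedge a = a;
  candxT : forall a : M, a \wedge cT = a;
  corFx : forall a : M, cF \vee a = a;
  corxF : forall a : M, a \vee cF = a;
  cnegU : \neg cU = cU
}.

#[short(type="cAlgebraTFUType")]
HB.structure Definition CAlgebraTFU := { M of CAlgebra M & CAlgebra_hasTFU M }.

HB.mixin Record CAlgebraTFU_isAda M of CAlgebraTFU M := {
  down : M -> M;
  downF : down cF = cF;
  downU : down cU = cF;
  downT : down cT = cT;
  cand_down : forall a b : M, a \wedge down b = a \wedge down (a \wedge b);
  down_compl : forall a : M, down a \vee \neg (down a) = cT;
  down_or : forall a : M, a = down a \vee a
}.

#[short(type="adaType")]
HB.structure Definition Ada := { M of CAlgebraTFU M & CAlgebraTFU_isAda M }.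

Notation "x ^dn" := (down x) : calgebra_scope.

Definition cle (M : cAlgebraType) (a b : M) : Prop := a \vee b = b.

Definition sharp (M : cAlgebraTFUType) : set M := [set a | a \vee \neg a = cT].
Arguments sharp M : clear implicits.

Definition atoms (M : cAlgebraTFUType) (A : set M) : set M :=
  [set a | [/\ A a, a <> cF &
    forall b, A b -> cle cF b -> cle b a -> b <> a -> b = cF]].

(* Only meant for sets [A] containing [cF]. *)
Definition atomless (M : cAlgebraTFUType) (A : set M) : Prop :=
  atoms A = set0.

(* Main.v *)
(** Let [s = (¬ a)^dn]; in three-valued terms [¬ s] is the support of [a], the
region where [a] is not [F], and it lies in [M_#]. If [a] is an atom of [M],
every [c] in [M_#] restricts [a] to some [c ∧ a <= a], which is [F] or [a].
For [c <= ¬ s] these alternatives force [c = F] or [c = ¬ s] respectively, so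
[¬ s] is an atom of [M_#]. *)
Require Import Defs.
From mathcomp Require Import all_boot boolp classical_sets.

Local Open Scope classical_set_scope.

Section CAlgebraTheory.
Local Open Scope calgebra_scope.
Context {M : cAlgebraType}.
Implicit Types a b c : M.

Lemma cneg_or a b : \neg (a \vee b) = \neg a \wedge \neg b.
Proof. by rewrite -[RHS]cnegK cneg_and !cnegK. Qed.

Lemma corA a b c : a \vee b \vee c = a \vee (b \vee c).
Proof. by rewrite -[LHS]cnegK !cneg_or candA -!cneg_or cnegK. Qed.

Lemma cand_absorb a b : a \wedge (a \vee b) = a.
Proof. by rewrite -[LHS]cnegK cneg_and (cneg_or a) cor_absorb cnegK. Qed.

Lemma cle_cand a b : cle a b -> a \wedge b = a.
Proof. by move=> ab; rewrite -[in LHS]ab cand_absorb. Qed.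

End CAlgebraTheory.

Section CAlgebraTFUTheory.
Local Open Scope calgebra_scope.
Context {M : cAlgebraTFUType}.
Implicit Types a c : M.

Lemma cneg_T : \neg (cT : M) = cF.
Proof. by rewrite -[LHS]corxF -[X in _ \vee X]cnegK -cneg_and candTx cnegK. Qed.

Lemma cneg_F : \neg (cF : M) = cT.
Proof. by rewrite -cneg_T cnegK. Qed.

Lemma corTx a : cT \vee a = cT.
Proof. by rewrite -[a]candTx cor_absorb. Qed.

Lemma candFx a : cF \wedge a = cF.
Proof. by rewrite -[LHS]corFx cor_absorb. Qed.

Lemma corxx a : a \vee a = a.
Proof. by rewrite -{2}[a]candxT cor_absorb. Qed.

Lemma candxx a : a \wedge a = a.
Proof. by rewrite -{2}[a]corxF cand_absorb. Qed.

(** [cT] absorbs only from the left: at [a = cU] both sides are [cU]. *)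
Lemma corxT a : a \vee cT = a \vee \neg a.
Proof. by rewrite -[LHS]candxT cand_orl !candxT. Qed.

Lemma candxF a : a \wedge cF = a \wedge \neg a.
Proof. by rewrite -[LHS]cnegK cneg_and cneg_F corxT cneg_or !cnegK. Qed.

(** Case distinction on [c]: expanding [(c \vee \neg c) \wedge a] by [cand_orl] duplicates [\neg c],
    and idempotence removes the copy. *)
Lemma sharp_split {c} a : sharp M c -> c \wedge a \vee \neg c \wedge a = a.
Proof.
by move=> cS; rewrite -[RHS]candTx -cS cand_orl candxx.
Qed.

Lemma sharp_negand {c} : sharp M c -> \neg c \wedge c = cF.
Proof. by move=> cS; rewrite -{2}[c]cnegK -cneg_or cS cneg_T. Qed.

(** Sharpness matters, since [cU \wedge cF = cU]. In the splitting of [cF] along [c], the part under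
    [\neg c] is [\neg c \wedge c = cF]. *)
Lemma sharp_candxF {c} : sharp M c -> c \wedge cF = cF.
Proof.
move=> cS; rewrite -[RHS](sharp_split cF cS).
by rewrite [\neg c \wedge _]candxF cnegK (sharp_negand cS) corxF.
Qed.

Lemma sharp_neg {c} : sharp M c -> sharp M (\neg c).
Proof.
move=> cS; rewrite /sharp /= -cneg_and -candxF (sharp_candxF cS).
exact: cneg_F.
Qed.

Lemma cle_sharp_cand {c} a : sharp M c -> cle (c \wedge a) a.
Proof.
by move=> cS; rewrite /cle -{2}(sharp_split a cS) -corA corxx sharp_split.
Qed.

End CAlgebraTFUTheory.

Section AdaTheory.
Local Open Scope calgebra_scope.
Context {M : adaType}.
Implicit Types a c : M.

Lemma sharp_down a : sharp M a^dn.
Proof. exact: down_compl. Qed.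

Lemma down_eqT a : a^dn = cT -> a = cT.
Proof. by move=> aT; rewrite (down_or a) aT corTx. Qed.

Lemma cand_down_self a : a \wedge a^dn = a.
Proof. by rewrite -[in a^dn](candxT a) -cand_down downT candxT. Qed.

(** De Morgan turns disjointness into [c \wedge \neg a = c]; under [c], the axiom [cand_down] then
    replaces [(\neg a)^dn] by [c^dn]. *)
Lemma cand_eqF_down {a c} : sharp M c -> c \wedge a = cF ->
  c \wedge (\neg a)^dn = c.
Proof.
move=> cS caF; have cna : c \wedge \neg a = c.
  have : c \wedge (\neg c \vee \neg a) = c by rewrite -cneg_and caF cneg_F candxT.
  by rewrite cand_orr -candxF (sharp_candxF cS) corFx.
by rewrite cand_down cna cand_down_self.
Qed.

Lemma atom_support a :
  atoms [set: M] a -> atoms (sharp M) (\neg (\neg a)^dn).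
Proof.
case=> _ aF atom_a; set s := (\neg a)^dn.
have sS : sharp M s := sharp_down _.
split; first exact: sharp_neg.
  move=> sF; apply: aF; rewrite -[a]cnegK (down_eqT (\neg a)) ?cneg_T//.
  by rewrite -/s -[s]cnegK sF cneg_F.
move=> c cS _ cs c_neq.
have [caE|caN] := pselect (c \wedge a = a).
  (* Here [c] covers [a], so [\neg c] is disjoint from [a] and [\neg c \wedge s = \neg c]. Negating
     gives [c = c \vee \neg s], which is [\neg s] by [cs]. *)
  have ncaF : \neg c \wedge a = cF.
    by rewrite -caE -candA (sharp_negand cS) candFx.
  have ncs := cand_eqF_down (sharp_neg cS) ncaF.
  by case: c_neq; rewrite -[LHS]cnegK -ncs cneg_and cnegK.
have caF : c \wedge a = cF.
  apply: atom_a => //; [exact: corFx | exact: cle_sharp_cand].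
(* Now [c] absorbs both [s], by disjointness from [a], and [\neg s], by [cs]; hence [c = c \wedge
   (\neg s \wedge s) = c \wedge cF]. *)
rewrite -(cand_eqF_down cS caF) -/s -(cle_cand _ _ cs) candA (sharp_negand sS).
exact: sharp_candxF.
Qed.

End AdaTheory.

Theorem theorem2p46 (M : adaType) : atomless (sharp M) -> atomless [set: M].
Proof.
move=> M0; rewrite /atomless -subset0 => a /atom_support.
by rewrite [atoms (sharp M)]M0.
Qed.
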